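(* Let $\overline{y}$ be the vector of all step values and internal stages computed by $K$ steps of the IDT (incremental direction technique) relaxation Runge-Kutta method, and let $\widetilde E$ be the associated reduced state-equation operator (see context). For any right-hand side $\overline{w}=(w_0,W_1,w_1,\dots,W_K,w_K)\in\mathbb R^{\overline N}$, the adjoint IDT system $\widetilde E'(\overline y)^\top\,\overline\lambda=\overline w$ for $\overline\lambda=(\lambda_0,\Lambda_1,\lambda_1,\dots,\Lambda_K,\lambda_K)$ is given by the following time-stepping formulas (back substitution): $\lambda_K=w_K$ and, for $k=K,K-1,\dots,1$, $$\lambda_{k-1}=\lambda_k+\sum_{i=1}^s\Lambda_{k,i}+\xi_k\nabla_y\gamma_k+w_{k-1},$$ where $$\xi_k=\Delta t\sum_{i=1}^s b_iF_{k,i}^\top\lambda_k,$$ $$\Lambda_{k,i}=\Delta t\,J_{k,i}^\top\Big(\gamma_kb_i\lambda_k+\sum_{j=1}^s a_{ji}\Lambda_{k,j}\Big)+\xi_k\nabla_Y\gamma_{k,i}+W_{k,i},\qquad i=1,\dots,s.$$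
   Context: Consider the initial value problem $y'(t)=f(y(t),t)$, $0<t\le T$, $y(0)=y_{\rm init}\in\mathbb R^N$, with $f$ differentiable in $y$ and a smooth convex entropy function $\eta:\mathbb R^N\to\mathbb R$. Fix an $s$-stage Runge-Kutta method with coefficients $a_{ij},b_i,c_i$ ($1\le i,j\le s$), step size $\Delta t>0$, and times $t_k=t_{k-1}+\Delta t$. Vectors of length $\overline N=N+N(s+1)K$ are written in blocks as $\overline y=(y_0,Y_1,y_1,\dots,Y_K,y_K)$ with $y_k\in\mathbb R^N$ and $Y_k=(Y_{k,1},\dots,Y_{k,s})\in\mathbb R^{sN}$; the same convention is used for $\overline w=(w_0,W_1,w_1,\dots)$ and $\overline\lambda=(\lambda_0,\Lambda_1,\lambda_1,\dots)$. Set $$F_{k,i}=f(Y_{k,i},t_{k-1}+c_i\Delta t),\qquad J_{k,i}=\frac{\partial f}{\partial y}(Y_{k,i},t_{k-1}+c_i\Delta t).$$ IDT method: $y_0=y_{\rm init}$ and, for $k=1,\dots,K$, $Y_{k,i}=y_{k-1}+\Delta t\sum_{j}a_{ij}F_{k,j}$ and $y_k=y_{k-1}+\gamma_k\Delta t\sum_i b_iF_{k,i}$, where the relaxation parameter $\gamma_k$ is the non-zero root closest to $1$ of $$r_k(\gamma;\overline y)=\eta\Big(y_{k-1}+\gamma\Delta t\sum_{i}b_iF_{k,i}\Big)-\eta(y_{k-1})-\gamma\Delta t\sum_{i}b_i\nabla\eta(Y_{k,i})^\top F_{k,i}.$$ The equation $r_k(\gamma_k;\overline y)=0$ implicitly defines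 $\gamma_k=\gamma_k(\overline y)$ as a differentiable function of $(y_{k-1},Y_k)$ only (these being regarded as independent variables); it is assumed that this root exists and $\partial r_k/\partial\gamma\ne0$ there. Its gradients are, by implicit differentiation, $$(\nabla_y\gamma_k)^\top=\frac{\partial\gamma_k}{\partial y_{k-1}}=-\Big(\frac{\partial r_k}{\partial\gamma}\Big)^{-1}\frac{\partial r_k}{\partial y_{k-1}},\qquad(\nabla_Y\gamma_{k,i})^\top=\frac{\partial\gamma_k}{\partial Y_{k,i}}=-\Big(\frac{\partial r_k}{\partial\gamma}\Big)^{-1}\frac{\partial r_k}{\partial Y_{k,i}},$$ evaluated at $\gamma=\gamma_k$. The reduced state-equation operator $\widetilde E:\mathbb R^{\overline N}\to\mathbb R^{\overline N}$ (defined near $\overline y$) has blocks, in the same ordering: initial block $y_0-y_{\rm init}$; and for each $k=1,\dots,K$ the stage blocks $Y_{k,i}-y_{k-1}-\Delta t\sum_ja_{ij}F_{k,j}$ ($i=1,\dots,s$) followed by the step block $y_k-y_{k-1}-\gamma_k(\overline y)\,\Delta t\sum_ib_iF_{k,i}$. $\widetilde E'(\overline y)$ denotes its Jacobian matrix, including the dependence of $\gamma_k$ on $\overline y$. *)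

(* Defs.v *)
From HB Require Import structures.
From mathcomp Require Import all_boot all_order all_algebra.
From mathcomp Require Import all_classical all_reals all_analysis.
Set Implicit Arguments.
Unset Strict Implicit.
Unset Printing Implicit Defensive.
Import Order.TTheory GRing.Theory Num.Theory.
Import numFieldNormedType.Exports.
Local Open Scope classical_set_scope.
Local Open Scope ring_scope.

(* Vectors of R^n are row vectors 'rV[R]_n.  The library Jacobian 'J acts on
   row vectors from the right, so its (i, j) entry is d f_j / d x_i; [Jac] is
   its transpose, the usual Jacobian matrix with entries d f_i / d x_j.  Under
   this encoding the vector J^T v is the row vector v *m J. *)
Definition Jac (R : realType) (m n : nat) (f : 'rV[R]_m -> 'rV[R]_n)
  (x : 'rV[R]_m) : 'M[R]_(n, m) := ('J f x)^T.

Definition grad (R : realType) (n : nat) (g : 'rV[R]_n -> R)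
  (x : 'rV[R]_n) : 'rV[R]_n := \row_j 'D_(delta_mx 0 j) g x.

Definition dotv (R : realType) (n : nat) (u v : 'rV[R]_n) : R :=
  \sum_j u 0 j * v 0 j.

(* C^oo: all iterated partial derivatives (js lists the coordinates along
   which one differentiates, innermost last) are differentiable everywhere. *)
Definition smooth (R : realType) (n : nat) (g : 'rV[R]_n -> R) : Prop :=
  forall (js : seq 'I_n) (x : 'rV[R]_n),
    differentiable
      (foldr (fun j (h : 'rV[R]_n -> R) z => 'D_(delta_mx 0 j) h z) g js) x.

Definition setrow (R : realType) (s N : nat) (Y : 'M[R]_(s, N)) (i : 'I_s)
  (z : 'rV[R]_N) : 'M[R]_(s, N) :=
  \matrix_(j < s) (if j == i then z else row j Y).

(* A block vector (v_0, V_1, v_1, ..., V_K, v_K) is stored flat, in this order;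
   bdim N s K = N + N (s + 1) K.  The s stages of V_k are the rows of an
   s x N matrix. *)
Notation bdim N s K := (N + K * (s * N + N))%N.

Definition bpack (R : realType) (N s K : nat) (v0 : 'rV[R]_N)
  (V : 'I_K -> 'M[R]_(s, N)) (v : 'I_K -> 'rV[R]_N) : 'rV[R]_(bdim N s K) :=
  row_mx v0 (mxvec (\matrix_(k < K) row_mx (mxvec (V k)) (v k))).

(* Time steps k = 1, ..., K are indexed by k : 'I_K starting at 0: the index k
   stands for the step from [prevpt k] to [nextpt k], i.e. step k + 1. *)
Definition prevpt (K : nat) (k : 'I_K) : 'I_K.+1 := widen_ord (leqnSn K) k.
Definition nextpt (K : nat) (k : 'I_K) : 'I_K.+1 := lift ord0 k.

Definition bblock (R : realType) (N s K : nat) (v : 'rV[R]_(bdim N s K))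
  (k : 'I_K) : 'rV[R]_(s * N + N) := row k (vec_mx (rsubmx v)).

Definition stages (R : realType) (N s K : nat) (v : 'rV[R]_(bdim N s K))
  (k : 'I_K) : 'M[R]_(s, N) := vec_mx (lsubmx (bblock v k)).

Definition stage (R : realType) (N s K : nat) (v : 'rV[R]_(bdim N s K))
  (k : 'I_K) (i : 'I_s) : 'rV[R]_N := row i (stages v k).

Definition stepv (R : realType) (N s K : nat) (v : 'rV[R]_(bdim N s K))
  (j : 'I_K.+1) : 'rV[R]_N :=
  if unlift ord0 j is Some k then rsubmx (bblock v k) else lsubmx v.

Record tableau (R : realType) (s : nat) := Tableau {
  rka : 'I_s -> 'I_s -> R;
  rkb : 'I_s -> R;
  rkc : 'I_s -> R }.

(* t_{k-1} + c_i dt for the step with 0-based index k, where t_j = j dt. *)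
Definition stage_time (R : realType) (s K : nat) (rk : tableau R s) (dt : R)
  (k : 'I_K) (i : 'I_s) : R := dt *+ k + rkc rk i * dt.

Definition Fst (R : realType) (N s K : nat) (f : 'rV[R]_N -> R -> 'rV[R]_N)
  (rk : tableau R s) (dt : R) (k : 'I_K) (Y : 'M[R]_(s, N)) (i : 'I_s)
  : 'rV[R]_N := f (row i Y) (stage_time rk dt k i).

Definition Jst (R : realType) (N s K : nat) (f : 'rV[R]_N -> R -> 'rV[R]_N)
  (rk : tableau R s) (dt : R) (k : 'I_K) (Y : 'M[R]_(s, N)) (i : 'I_s)
  : 'M[R]_N := Jac (f ^~ (stage_time rk dt k i)) (row i Y).

Definition relax_res (R : realType) (N s K : nat)
  (f : 'rV[R]_N -> R -> 'rV[R]_N) (eta : 'rV[R]_N -> R) (rk : tableau R s)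
  (dt : R) (k : 'I_K) (g : R) (y : 'rV[R]_N) (Y : 'M[R]_(s, N)) : R :=
  eta (y + (g * dt) *: \sum_i rkb rk i *: Fst f rk dt k Y i) - eta y
  - g * dt * \sum_i rkb rk i * dotv (grad eta (row i Y)) (Fst f rk dt k Y i).

Definition closest_root (R : realType) (r : R -> R) (g : R) : Prop :=
  [/\ g != 0, r g = 0 &
      forall h : R, h != 0 -> r h = 0 -> `|g - 1| <= `|h - 1|].

(* The values gamma_k(y) are obtained from functions of (y_{k-1}, Y_k) alone. *)
Definition gammav (R : realType) (N s K : nat)
  (gamma : 'I_K -> 'rV[R]_N * 'M[R]_(s, N) -> R) (y : 'rV[R]_(bdim N s K))
  (k : 'I_K) : R := gamma k (stepv y (prevpt k), stages y k).

Definition grad_y_gamma (R : realType) (N s K : nat)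
  (gamma : 'I_K -> 'rV[R]_N * 'M[R]_(s, N) -> R) (y : 'rV[R]_(bdim N s K))
  (k : 'I_K) : 'rV[R]_N :=
  grad (fun z => gamma k (z, stages y k)) (stepv y (prevpt k)).

Definition grad_Y_gamma (R : realType) (N s K : nat)
  (gamma : 'I_K -> 'rV[R]_N * 'M[R]_(s, N) -> R) (y : 'rV[R]_(bdim N s K))
  (k : 'I_K) (i : 'I_s) : 'rV[R]_N :=
  grad (fun z => gamma k (stepv y (prevpt k), setrow (stages y k) i z))
       (stage y k i).

Definition dr_dg (R : realType) (N s K : nat)
  (f : 'rV[R]_N -> R -> 'rV[R]_N) (eta : 'rV[R]_N -> R) (rk : tableau R s)
  (dt : R) (y : 'rV[R]_(bdim N s K)) (k : 'I_K) (g : R) : R :=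
  derive1 (fun h : R =>
    relax_res f eta rk dt k h (stepv y (prevpt k)) (stages y k)) g.

Definition dr_dy (R : realType) (N s K : nat)
  (f : 'rV[R]_N -> R -> 'rV[R]_N) (eta : 'rV[R]_N -> R) (rk : tableau R s)
  (dt : R) (y : 'rV[R]_(bdim N s K)) (k : 'I_K) (g : R) : 'rV[R]_N :=
  grad (fun z => relax_res f eta rk dt k g z (stages y k))
       (stepv y (prevpt k)).

Definition dr_dY (R : realType) (N s K : nat)
  (f : 'rV[R]_N -> R -> 'rV[R]_N) (eta : 'rV[R]_N -> R) (rk : tableau R s)
  (dt : R) (y : 'rV[R]_(bdim N s K)) (k : 'I_K) (g : R) (i : 'I_s)
  : 'rV[R]_N :=
  grad (fun z => relax_res f eta rk dt k g (stepv y (prevpt k))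
                   (setrow (stages y k) i z))
       (stage y k i).

(* gamma_k is a differentiable function near (y_{k-1}, Y_k) that solves
   r_k = 0 there, and d r_k / d gamma does not vanish at gamma_k. *)
Definition implicit_gamma (R : realType) (N s K : nat)
  (f : 'rV[R]_N -> R -> 'rV[R]_N) (eta : 'rV[R]_N -> R) (rk : tableau R s)
  (dt : R) (gamma : 'I_K -> 'rV[R]_N * 'M[R]_(s, N) -> R)
  (y : 'rV[R]_(bdim N s K)) : Prop :=
  forall k : 'I_K,
    (\forall z \near (stepv y (prevpt k), stages y k),
       differentiable (gamma k) z /\
       relax_res f eta rk dt k (gamma k z) z.1 z.2 = 0) /\
    dr_dg f eta rk dt y k (gammav gamma y k) != 0.

Definition IDT_solution (R : realType) (N s K : nat)
  (f : 'rV[R]_N -> R -> 'rV[R]_N) (eta : 'rV[R]_N -> R) (yinit : 'rV[R]_N)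
  (rk : tableau R s) (dt : R) (gam : 'I_K -> R) (y : 'rV[R]_(bdim N s K))
  : Prop :=
  [/\ stepv y ord0 = yinit,
      forall (k : 'I_K) (i : 'I_s),
        stage y k i = stepv y (prevpt k)
          + dt *: \sum_j rka rk i j *: Fst f rk dt k (stages y k) j,
      forall k : 'I_K,
        stepv y (nextpt k) = stepv y (prevpt k)
          + (gam k * dt) *: \sum_i rkb rk i *: Fst f rk dt k (stages y k) i &
      forall k : 'I_K,
        closest_root
          (fun g => relax_res f eta rk dt k g (stepv y (prevpt k)) (stages y k))
          (gam k)].

Definition Etilde (R : realType) (N s K : nat)
  (f : 'rV[R]_N -> R -> 'rV[R]_N) (yinit : 'rV[R]_N) (rk : tableau R s)
  (dt : R) (gamma : 'I_K -> 'rV[R]_N * 'M[R]_(s, N) -> R)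
  (y : 'rV[R]_(bdim N s K)) : 'rV[R]_(bdim N s K) :=
  bpack
    (stepv y ord0 - yinit)
    (fun k => \matrix_(i < s)
       (stage y k i - stepv y (prevpt k)
        - dt *: \sum_j rka rk i j *: Fst f rk dt k (stages y k) j))
    (fun k =>
       stepv y (nextpt k) - stepv y (prevpt k)
       - (gammav gamma y k * dt)
           *: \sum_i rkb rk i *: Fst f rk dt k (stages y k) i).

Definition xi (R : realType) (N s K : nat) (f : 'rV[R]_N -> R -> 'rV[R]_N)
  (rk : tableau R s) (dt : R) (y lam : 'rV[R]_(bdim N s K)) (k : 'I_K) : R :=
  dt * \sum_i rkb rk i
         * dotv (Fst f rk dt k (stages y k) i) (stepv lam (nextpt k)).

(* Main.v *)
From HB Require Import structures.
Require Import Defs.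
From mathcomp Require Import all_boot all_order all_algebra.
From mathcomp Require Import all_classical all_reals all_analysis.
From mathcomp Require Import ring.
Import Order.TTheory GRing.Theory Num.Theory.
Import numFieldNormedType.Exports.
Local Open Scope classical_set_scope.
Local Open Scope ring_scope.
Set Implicit Arguments.
Unset Strict Implicit.
Unset Printing Implicit Defensive.

(** Pair the Jacobian of the reduced state operator with a direction [h] and a
    multiplier [lam].  The transposed Jacobian applied to [lam] is the unique
    vector [A] such that [dotv (dEtilde h) lam = dotv h A] for every [h]; the
    adjoint system is therefore [A = w], and this equation, read block by
    block, is the list of time-stepping formulas.

    Three things carry the argument.

    The scheme has to be linearized ([is_diff_Etilde]).  All blocks are
    built from linear extractions of blocks of [y], from the right-hand side,
    and from the relaxation parameter; since a matrix-valued map is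
    differentiable as soon as its entries are ([is_diff_mx]), its differential
    can be computed block by block.  The parameter [gamma_k] sees only the
    previous step and the current stages, so its differential is the pairing
    of the direction with the gradients in these two groups of variables
    ([is_diff_gammav]).

    The differential has to be transposed ([dEtilde_adjoint]).  Within one
    step this is an exchange of the two sums over stages, and the scalar [xi]
    appears as the factor of the variation of [gamma_k] in the pairing
    ([dotv_one_step]).  Across the steps, the value
    [y_{k-1}] occurs both as the outcome of one step and as the starting point
    of the next one, and a summation by parts in [k] collects the two
    contributions.

    The formulas for the gradients of [gamma_k] are implicit differentiation
    ([implicit_grad]).  It needs the residual to be differentiable jointly in
    the parameter, the step value and the stages
    ([differentiable_relax_res]): the chain rule is applied along the graph
    of the parameter as a function of the other two. *)

(** * Calculus in coordinates *)

Lemma is_diff_linear (R : realType) (V W : normedModType R) (L : V -> W)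
  (x : V) : linear L -> continuous L -> is_diff x L L.
Proof.
move=> linL contL.
pose B := GRing.isLinear.Build R V W *:%R L linL.
pose L' : {linear V -> W} := HB.pack L B.
have -> : L = L' by [].
by apply: DiffDef; [exact: linear_differentiable | rewrite diff_lin].
Qed.

(** A linear map on matrices is the finite sum of its values on the elementary
    matrices weighted by the entries, so it inherits the continuity of the
    entries. *)
Lemma linear_mx_continuous (R : realType) (m n : nat) (W : normedModType R)
  (L : 'M[R]_(m, n) -> W) : linear L -> continuous L.
Proof.
move=> linL x.
pose B := GRing.isLinear.Build R 'M[R]_(m, n) W *:%R L linL.
pose L' : {linear 'M[R]_(m, n) -> W} := HB.pack L B.
have -> : L = fun A => \sum_i \sum_j A i j *: L (delta_mx i j).
  apply/funext => A; rewrite -[L]/(L' : _ -> _) [in LHS](matrix_sum_delta A).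
  rewrite linear_sum; apply: eq_bigr => i _; rewrite linear_sum.
  by apply: eq_bigr => j _; rewrite linearZ.
apply: differentiable_continuous.
have -> : (fun A : 'M[R]_(m, n) => \sum_i \sum_j A i j *: L (delta_mx i j)) =
   \sum_i \sum_j (fun A : 'M[R]_(m, n) => A i j *: L (delta_mx i j)).
  apply/funext => A; rewrite fct_sumE; apply: eq_bigr => i _.
  by rewrite fct_sumE.
apply: differentiable_sum => i; apply: differentiable_sum => j.
by apply: differentiableZl; exact: differentiable_coord.
Qed.

Lemma is_diff_linear_mx (R : realType) (m n : nat) (W : normedModType R)
  (L : 'M[R]_(m, n) -> W) (x : 'M[R]_(m, n)) : linear L -> is_diff x L L.
Proof.
by move=> linL; apply: is_diff_linear => //; exact: linear_mx_continuous.
Qed.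

Lemma is_diff_sum (R : realType) (V W : normedModType R) (n : nat)
  (F dF : 'I_n -> V -> W) (x : V) :
  (forall i, is_diff x (F i) (dF i)) ->
  is_diff x (fun z => \sum_i F i z) (fun h => \sum_i dF i h).
Proof.
have sumE (G : 'I_n -> V -> W) : (fun z => \sum_i G i z) = \sum_i G i.
  by apply/funext => z; rewrite fct_sumE.
move=> hF; rewrite !sumE {sumE}.
elim: n F dF hF => [|n IH] F dF hF.
  by rewrite !big_ord0; exact: is_diff_cst.
by rewrite !big_ord_recl; apply: is_diffD.
Qed.

(** Decomposing along the elementary matrices reduces matrix-valued
    differentials to scalar ones; product rules and block rules then follow
    from their scalar versions. *)
Lemma is_diff_mx (R : realType) (V : normedModType R) (m n : nat)
  (M dM : V -> 'M[R]_(m, n)) (x : V) :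
  (forall i j, is_diff x (fun z => M z i j) (fun h => dM h i j)) ->
  is_diff x M dM.
Proof.
move=> hM.
have sumE (A : 'M[R]_(m, n)) : A = \sum_i \sum_j A i j *: delta_mx i j.
  exact: matrix_sum_delta.
have -> : M = fun z => \sum_i \sum_j M z i j *: delta_mx i j.
  by apply/funext => z; exact: sumE.
have -> : dM = fun h => \sum_i \sum_j dM h i j *: delta_mx i j.
  by apply/funext => h; exact: sumE.
apply: is_diff_sum => i; apply: is_diff_sum => j.
have hij := hM i j.
apply: DiffDef; first by apply: differentiableZl; exact: ex_diff.
by rewrite diffZl ?diff_val.
Qed.

Lemma is_diff_entry (R : realType) (V : normedModType R) (m n : nat)
  (M dM : V -> 'M[R]_(m, n)) (x : V) (i : 'I_m) (j : 'I_n) :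
  is_diff x M dM -> is_diff x (fun z => M z i j) (fun h => dM h i j).
Proof.
move=> hM.
apply: (@is_diff_comp _ _ _ _ M dM (fun A => A i j) (fun A => A i j)) => //.
by apply: is_diff_linear_mx => a A B; rewrite !mxE.
Qed.

Lemma is_diff_scale (R : realType) (V : normedModType R) (m n : nat)
  (k dk : V -> R) (M dM : V -> 'M[R]_(m, n)) (x : V) :
  is_diff x k dk -> is_diff x M dM ->
  is_diff x (fun z => k z *: M z) (fun h => k x *: dM h + dk h *: M x).
Proof.
move=> hk hM; apply: is_diff_mx => i j.
have hMij := is_diff_entry i j hM.
have -> : (fun z => (k z *: M z) i j) = k * (fun z => M z i j).
  by apply/funext => z; rewrite mxE.
have h := is_diffM hk hMij.
by apply: is_diff_eq h _; apply/funext => h; rewrite !mxE [dk h * _]mulrC.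
Qed.

(** * Gradients and implicit differentiation *)

Lemma diff_dotv (R : realType) (n : nat) (g : 'rV[R]_n -> R)
  (x h : 'rV[R]_n) : differentiable g x -> 'd g x h = dotv h (grad g x).
Proof.
move=> dg; rewrite [in LHS](row_sum_delta h) linear_sum.
by apply: eq_bigr => j _; rewrite linearZ mxE deriveE.
Qed.

(** The total differential of [r (gam u) u = 0] along [phi] vanishes, and it is
    the derivative of [r] in its first argument times the differential of
    [gam \o phi], plus the differential of [r] in its second argument along
    [phi].  The map
    [phi] selects the group of variables with respect to which the gradient
    is taken, the others being held fixed. *)
Lemma implicit_grad (R : realType) (U : normedModType R) (n : nat)
  (r : R -> U -> R) (gam : U -> R) (phi : 'rV[R]_n -> U) (z0 : 'rV[R]_n)
  (u0 : U) :
  phi z0 = u0 -> differentiable phi z0 -> differentiable gam u0 ->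
  differentiable (fun q : R * U => r q.1 q.2) (gam u0, u0) ->
  (\forall u \near u0, r (gam u) u = 0) ->
  derive1 (r ^~ u0) (gam u0) != 0 ->
  grad (gam \o phi) z0 =
    - (derive1 (r ^~ u0) (gam u0))^-1 *: grad (fun z => r (gam u0) (phi z)) z0.
Proof.
move=> <-; set g0 := gam (phi z0) => dphi dgam dr r0 rg.
set rr := (fun q : R * U => r q.1 q.2) in dr.
pose Dr := 'd rr (g0, phi z0).
have idphi := differentiableP dphi.
have idgam := differentiableP dgam.
have idr := differentiableP dr.
have Dg : derive1 (r ^~ (phi z0)) g0 = Dr (1, 0).
  have h : is_diff g0 (fun g : R => (g, phi z0)) (fun g : R => (g, 0)).
    exact: (is_diff_pair (is_diff_id g0) (is_diff_cst (phi z0) g0)).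
  have h1 : is_diff g0 (rr \o (fun g : R => (g, phi z0)))
     (Dr \o (fun g : R => (g, 0))) := is_diff_comp h idr.
  by rewrite derive1E' ?diff_val.
have h2 : is_diff z0 (rr \o (fun z => (g0, phi z)))
     (Dr \o (fun h => (0, 'd phi z0 h))).
  exact: is_diff_comp (is_diff_pair (is_diff_cst g0 z0) idphi) idr.
have h3 : is_diff z0 (gam \o phi) ('d gam (phi z0) \o 'd phi z0).
  exact: is_diff_comp.
have h4 : is_diff z0 (rr \o (fun z => ((gam \o phi) z, phi z)))
     (Dr \o (fun h => (('d gam (phi z0) \o 'd phi z0) h, 'd phi z0 h))).
  exact: is_diff_comp (is_diff_pair h3 idphi) idr.
apply/rowP => j; rewrite !mxE; set e := delta_mx 0 j.
(* Near z0 the pair (gam u, u) at u = phi z stays on the zero set of rr. *)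
have E4 : 'D_e (rr \o (fun z => ((gam \o phi) z, phi z))) z0 = 0.
  rewrite (@near_eq_derive _ _ _ _ (cst 0)) ?derive_cst //.
  exact: (differentiable_continuous dphi r0).
have isD (V W : normedModType R) (g dg : V -> W) x v :
    is_diff x g dg -> 'D_v g x = dg v.
  by move=> dgx; rewrite deriveE ?diff_val //; exact: ex_diff.
rewrite (isD _ _ _ _ _ e h3) (isD _ _ _ _ _ e h2) Dg /=.
move: E4; rewrite (isD _ _ _ _ _ e h4) /=.
set a := 'd gam _ _; set b := 'd phi _ _.
have -> : (a, b) = a *: (1, 0) + (0, b) :> R * U.
  by congr (_, _); rewrite /= ?scaler0 ?addr0 ?add0r // /GRing.scale /= mulr1.
rewrite linearD linearZ /= => /eqP; rewrite addr_eq0 => /eqP E.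
have D0 : Dr (1, 0) != 0 by rewrite -Dg.
by apply: (mulIf D0); rewrite mulrAC mulNr mulVf // mulN1r -E.
Qed.

(** Smoothness of [eta] enters twice: at order one for the entropy itself and at
    order two because the residual contains the gradient of [eta] at the
    stages. *)
Lemma differentiable_relax_res (R : realType) (N s K : nat)
  (f : 'rV[R]_N -> R -> 'rV[R]_N) (eta : 'rV[R]_N -> R) (rk : tableau R s)
  (dt : R) (k : 'I_K) (q : R * ('rV[R]_N * 'M[R]_(s, N))) :
  (forall (t : R) (y : 'rV[R]_N), differentiable (f ^~ t) y) ->
  smooth eta ->
  differentiable (fun q : R * ('rV[R]_N * 'M[R]_(s, N)) =>
    relax_res f eta rk dt k q.1 q.2.1 q.2.2) q.
Proof.
move=> hf heta.
have dfst (V W : normedModType R) (p : V * W) : differentiable fst p.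
  by apply: linear_differentiable => x; exact: cvg_fst.
have dsnd (V W : normedModType R) (p : V * W) : differentiable snd p.
  by apply: linear_differentiable => x; exact: cvg_snd.
have dg : differentiable (fst : R * ('rV[R]_N * 'M[R]_(s, N)) -> R) q.
  exact: dfst.
have dy : differentiable (fun q : R * ('rV[R]_N * 'M[R]_(s, N)) => q.2.1) q.
  exact: differentiable_comp (dsnd _ _ q) (dfst _ _ q.2).
have drow i : differentiable
    (fun q : R * ('rV[R]_N * 'M[R]_(s, N)) => row i q.2.2) q.
  apply: differentiable_comp
    (differentiable_comp (dsnd _ _ q) (dsnd _ _ q.2)) _.
  by case: (is_diff_linear_mx q.2.2 (@linearP _ _ _ _ (row i))).
have deta y : differentiable eta y by have := heta [::] y.
have dF i : differentiable
    (fun q : R * ('rV[R]_N * 'M[R]_(s, N)) => Fst f rk dt k q.2.2 i) q.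
  exact: differentiable_comp (drow i) (hf (stage_time rk dt k i) _).
have dgrad i j : differentiable
    (fun q : R * ('rV[R]_N * 'M[R]_(s, N)) => grad eta (row i q.2.2) 0 j) q.
  have -> : (fun q : R * ('rV[R]_N * 'M[R]_(s, N)) =>
      grad eta (row i q.2.2) 0 j) =
      (fun z => 'D_(delta_mx 0 j) eta z) \o (fun q => row i q.2.2).
    by apply/funext => z; rewrite /= mxE.
  exact: differentiable_comp (drow i) (heta [:: j] _).
have dFj i j : differentiable
    (fun q : R * ('rV[R]_N * 'M[R]_(s, N)) => Fst f rk dt k q.2.2 i 0 j) q.
  exact: differentiable_comp (dF i) (differentiable_coord _ 0 j).
have dsum (V W : normedModType R) n (F : 'I_n -> V -> W) x :
    (forall i, differentiable (F i) x) ->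
    differentiable (fun z => \sum_i F i z) x.
  by move=> hF; case: (is_diff_sum (fun i => differentiableP (hF i))).
have dgdt : differentiable
    (fun q : R * ('rV[R]_N * 'M[R]_(s, N)) => q.1 * dt) q.
  by apply: differentiableM.
apply: differentiableB.
  apply: differentiableB; last exact: differentiable_comp dy (deta _).
  have dinc : differentiable (fun q : R * ('rV[R]_N * 'M[R]_(s, N)) =>
      (q.1 * dt) *: \sum_i rkb rk i *: Fst f rk dt k q.2.2 i) q.
    have dS : differentiable (fun q : R * ('rV[R]_N * 'M[R]_(s, N)) =>
        \sum_i rkb rk i *: Fst f rk dt k q.2.2 i) q.
      by apply: (dsum) => i; apply: differentiableZ.
    by case: (is_diff_scale (differentiableP dgdt) (differentiableP dS)).
  exact: differentiable_comp (differentiableD dy dinc) (deta _).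
apply: differentiableM => //; apply: (dsum) => i; apply: differentiableM => //.
by apply: (dsum) => j; apply: differentiableM.
Qed.

(** * The Euclidean pairing *)

Lemma dotvE (R : realType) (n : nat) (u v : 'rV[R]_n) :
  dotv u v = (u *m v^T) 0 0.
Proof. by rewrite mxE; apply: eq_bigr => j _; rewrite mxE. Qed.

Lemma dotvC (R : realType) (n : nat) (u v : 'rV[R]_n) : dotv u v = dotv v u.
Proof. by apply: eq_bigr => j _; rewrite mulrC. Qed.

Lemma dotvDl (R : realType) (n : nat) (u1 u2 v : 'rV[R]_n) :
  dotv (u1 + u2) v = dotv u1 v + dotv u2 v.
Proof. by rewrite !dotvE mulmxDl mxE. Qed.

Lemma dotvZl (R : realType) (n : nat) (a : R) (u v : 'rV[R]_n) :
  dotv (a *: u) v = a * dotv u v.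
Proof. by rewrite !dotvE -scalemxAl mxE. Qed.

Lemma dotvBl (R : realType) (n : nat) (u1 u2 v : 'rV[R]_n) :
  dotv (u1 - u2) v = dotv u1 v - dotv u2 v.
Proof. by rewrite -scaleN1r dotvDl dotvZl mulN1r. Qed.

Lemma dotv_suml (R : realType) (n m : nat) (u : 'I_m -> 'rV[R]_n)
  (v : 'rV[R]_n) : dotv (\sum_i u i) v = \sum_i dotv (u i) v.
Proof.
by rewrite dotvE mulmx_suml summxE; apply: eq_bigr => i _; rewrite dotvE.
Qed.

Lemma dotvDr (R : realType) (n : nat) (u v1 v2 : 'rV[R]_n) :
  dotv u (v1 + v2) = dotv u v1 + dotv u v2.
Proof. by rewrite dotvC dotvDl !(dotvC u). Qed.

Lemma dotvZr (R : realType) (n : nat) (a : R) (u v : 'rV[R]_n) :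
  dotv u (a *: v) = a * dotv u v.
Proof. by rewrite dotvC dotvZl (dotvC u). Qed.

Lemma dotvBr (R : realType) (n : nat) (u v1 v2 : 'rV[R]_n) :
  dotv u (v1 - v2) = dotv u v1 - dotv u v2.
Proof. by rewrite dotvC dotvBl !(dotvC u). Qed.

Lemma dotv_sumr (R : realType) (n m : nat) (u : 'rV[R]_n)
  (v : 'I_m -> 'rV[R]_n) : dotv u (\sum_i v i) = \sum_i dotv u (v i).
Proof. by rewrite dotvC dotv_suml; apply: eq_bigr => i _; rewrite dotvC. Qed.

Lemma dotv_mulmxtr (R : realType) (n m : nat) (u : 'rV[R]_n)
  (J : 'M[R]_(m, n)) (v : 'rV[R]_m) : dotv (u *m J^T) v = dotv u (v *m J).
Proof. by rewrite !dotvE trmx_mul mulmxA. Qed.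

Lemma dotv_row_mx (R : realType) (m n : nat) (u1 v1 : 'rV[R]_m)
  (u2 v2 : 'rV[R]_n) :
  dotv (row_mx u1 u2) (row_mx v1 v2) = dotv u1 v1 + dotv u2 v2.
Proof. by rewrite !dotvE tr_row_mx mul_row_col mxE. Qed.

Lemma dotv_mxvec (R : realType) (m n : nat) (A B : 'M[R]_(m, n)) :
  dotv (mxvec A) (mxvec B) = \sum_i dotv (row i A) (row i B).
Proof.
rewrite pair_bigA /dotv (reindex _ (curry_mxvec_bij _ _)) /=.
by apply: eq_bigr => -[i j] _ /=; rewrite !mxvecE !mxE.
Qed.

(** * Block vectors *)

Lemma stepv_linear (R : realType) (N s K : nat) (j : 'I_K.+1) :
  linear (fun v : 'rV[R]_(bdim N s K) => stepv v j).
Proof.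
move=> a u v; rewrite /stepv; case: unlift => [k|];
  by apply/rowP => i; rewrite !mxE.
Qed.

Lemma stages_linear (R : realType) (N s K : nat) (k : 'I_K) :
  linear (fun v : 'rV[R]_(bdim N s K) => stages v k).
Proof. by move=> a u v; apply/matrixP => i j; rewrite !mxE. Qed.

Lemma stage_linear (R : realType) (N s K : nat) (k : 'I_K) (i : 'I_s) :
  linear (fun v : 'rV[R]_(bdim N s K) => stage v k i).
Proof. by move=> a u v; apply/rowP => j; rewrite !mxE. Qed.

Lemma stepv_nextpt (R : realType) (N s K : nat) (v : 'rV[R]_(bdim N s K))
  (k : 'I_K) : stepv v (nextpt k) = rsubmx (bblock v k).
Proof. by rewrite /stepv /nextpt liftK. Qed.

Lemma stepv_ord0 (R : realType) (N s K : nat) (v : 'rV[R]_(bdim N s K)) :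
  stepv v ord0 = lsubmx v.
Proof. by rewrite /stepv unlift_none. Qed.

Section Bpack.
Variables (R : realType) (N s K : nat).
Implicit Types (V : 'I_K -> 'M[R]_(s, N)) (v : 'I_K -> 'rV[R]_N).

Lemma bblock_bpack w V v k :
  bblock (bpack w V v) k = row_mx (mxvec (V k)) (v k).
Proof. by rewrite /bblock /bpack row_mxKr mxvecK rowK. Qed.

Lemma stepv_bpack0 (w : 'rV[R]_N) V v : stepv (bpack w V v) ord0 = w.
Proof. by rewrite stepv_ord0 row_mxKl. Qed.

Lemma stepv_bpackS (w : 'rV[R]_N) V v k : stepv (bpack w V v) (nextpt k) = v k.
Proof. by rewrite stepv_nextpt bblock_bpack row_mxKr. Qed.

Lemma stages_bpack w V v k : stages (bpack w V v) k = V k.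
Proof. by rewrite /stages bblock_bpack row_mxKl mxvecK. Qed.

Lemma stage_bpack w V v k i : stage (bpack w V v) k i = row i (V k).
Proof. by rewrite /stage stages_bpack. Qed.

Lemma bpackK (u : 'rV[R]_(bdim N s K)) :
  bpack (stepv u ord0) (stages u) (fun k => stepv u (nextpt k)) = u.
Proof.
rewrite /bpack stepv_ord0 -[RHS]hsubmxK; congr row_mx.
rewrite -[RHS]vec_mxK; congr mxvec; apply/row_matrixP => k.
by rewrite rowK stepv_nextpt /stages vec_mxK hsubmxK.
Qed.

Lemma bvec_ext (u v : 'rV[R]_(bdim N s K)) :
  (forall j, stepv u j = stepv v j) ->
  (forall k i, stage u k i = stage v k i) -> u = v.
Proof.
move=> hstep hstage; rewrite -[u]bpackK -[v]bpackK hstep.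
congr bpack; apply/funext => k; last exact: hstep.
by apply/row_matrixP => i; exact: hstage.
Qed.

(** The flat storage of block vectors is an isometry, which is what allows the
    transposed Jacobian to be computed block by block. *)
Lemma dotv_bvec (u v : 'rV[R]_(bdim N s K)) :
  dotv u v = \sum_j dotv (stepv u j) (stepv v j) +
             \sum_k \sum_i dotv (stage u k i) (stage v k i).
Proof.
rewrite -{1}[u]bpackK -{1}[v]bpackK dotv_row_mx dotv_mxvec.
rewrite big_ord_recl -addrA -big_split; congr (_ + _).
by apply: eq_bigr => k _; rewrite /= !rowK dotv_row_mx dotv_mxvec addrC.
Qed.

Lemma is_diff_bpack (V : normedModType R) (x : V)
  (u0 du0 : V -> 'rV[R]_N) (U dU : V -> 'I_K -> 'M[R]_(s, N))
  (u du : V -> 'I_K -> 'rV[R]_N) :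
  is_diff x u0 du0 ->
  (forall k, is_diff x (U ^~ k) (dU ^~ k)) ->
  (forall k, is_diff x (u ^~ k) (du ^~ k)) ->
  is_diff x (fun z => bpack (u0 z) (U z) (u z))
            (fun h => bpack (du0 h) (dU h) (du h)).
Proof.
move=> h0 hU hu.
have rowmx (m n : nat) (A dA : V -> 'rV[R]_m) (B dB : V -> 'rV[R]_n) :
    is_diff x A dA -> is_diff x B dB ->
    is_diff x (fun z => row_mx (A z) (B z)) (fun h => row_mx (dA h) (dB h)).
  move=> hA hB.
  have linl : linear (fun C : 'rV[R]_m => row_mx C (0 : 'rV[R]_n)).
    by move=> a C D; rewrite scale_row_mx add_row_mx scaler0 addr0.
  have linr : linear (fun C : 'rV[R]_n => row_mx (0 : 'rV[R]_m) C).
    by move=> a C D; rewrite scale_row_mx add_row_mx scaler0 addr0.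
  have E (C : V -> 'rV[R]_m) (D : V -> 'rV[R]_n) :
      (fun z => row_mx (C z) (D z)) =
      (fun z => row_mx (C z) 0) + (fun z => row_mx 0 (D z)).
    by apply/funext => z; rewrite fctE add_row_mx addr0 add0r.
  rewrite (E A B) (E dA dB); apply: is_diffD.
    exact: (is_diff_comp hA (is_diff_linear_mx (A x) linl)).
  exact: (is_diff_comp hB (is_diff_linear_mx (B x) linr)).
have dmxvec (m n : nat) (A dA : V -> 'M[R]_(m, n)) : is_diff x A dA ->
    is_diff x (fun z => mxvec (A z)) (fun h => mxvec (dA h)).
  move=> hA; have lin := @linearP _ _ _ _ (@mxvec R m n).
  exact: (is_diff_comp hA (is_diff_linear_mx (A x) lin)).
apply: (rowmx) => //; apply: (dmxvec); apply: is_diff_mx => k j.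
have -> : (fun z => (\matrix_k row_mx (mxvec (U z k)) (u z k)) k j) =
    fun z => row_mx (mxvec (U z k)) (u z k) 0 j.
  by apply/funext => z; rewrite mxE.
have -> : (fun z => (\matrix_k row_mx (mxvec (dU z k)) (du z k)) k j) =
    fun z => row_mx (mxvec (dU z k)) (du z k) 0 j.
  by apply/funext => z; rewrite mxE.
by apply: is_diff_entry; apply: (rowmx) => //; exact: dmxvec.
Qed.

End Bpack.

(** * The relaxation parameter *)

Lemma setrow_row (R : realType) (s N : nat) (Y : 'M[R]_(s, N)) (i : 'I_s) :
  setrow Y i (row i Y) = Y.
Proof.
by apply/row_matrixP => j; rewrite rowK; case: eqP => [->|].
Qed.

Lemma is_diff_setrow (R : realType) (s N : nat) (Y : 'M[R]_(s, N))
  (i : 'I_s) (z : 'rV[R]_N) : is_diff z (setrow Y i) (setrow 0 i).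
Proof.
have lin0 : linear (@setrow R s N 0 i).
  move=> a u v; apply/matrixP => k l; rewrite !mxE.
  by case: eqP => _; rewrite !mxE // mulr0 addr0.
have -> : setrow Y i = cst (setrow Y i 0) + setrow 0 i.
  apply/funext => u; apply/matrixP => k l; rewrite fctE !mxE.
  by case: eqP => _; rewrite !mxE ?add0r ?addr0.
rewrite -[X in is_diff _ _ X]add0r; apply: is_diffD.
exact: is_diff_linear_mx.
Qed.

Section Gamma.
Variables (R : realType) (N s K : nat).
Variable gamma : 'I_K -> 'rV[R]_N * 'M[R]_(s, N) -> R.
Variables (ybar : 'rV[R]_(bdim N s K)) (k : 'I_K).
Let u0 := (stepv ybar (prevpt k), stages ybar k).

Let is_diff_embed_y : is_diff (stepv ybar (prevpt k))
  (fun z => (z, stages ybar k)) (fun h => (h, 0)).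
Proof. exact: is_diff_pair (is_diff_id _) (is_diff_cst _ _). Qed.

Let is_diff_embed_Y i : is_diff (stage ybar k i)
  (fun z => (stepv ybar (prevpt k), setrow (stages ybar k) i z))
  (fun h => (0, setrow 0 i h)).
Proof. exact: is_diff_pair (is_diff_cst _ _) (is_diff_setrow _ _ _). Qed.

Let embed_Y_stage i :
  (stepv ybar (prevpt k), setrow (stages ybar k) i (stage ybar k i)) = u0.
Proof. by rewrite setrow_row. Qed.

Lemma grad_gamma (f : 'rV[R]_N -> R -> 'rV[R]_N) (eta : 'rV[R]_N -> R)
  (rk : tableau R s) (dt : R) (g := gammav gamma ybar k) :
  (forall (t : R) (y : 'rV[R]_N), differentiable (f ^~ t) y) ->
  smooth eta -> implicit_gamma f eta rk dt gamma ybar ->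
  grad_y_gamma gamma ybar k =
    - (dr_dg f eta rk dt ybar k g)^-1 *: dr_dy f eta rk dt ybar k g /\
  forall i : 'I_s,
    grad_Y_gamma gamma ybar k i =
      - (dr_dg f eta rk dt ybar k g)^-1 *: dr_dY f eta rk dt ybar k g i.
Proof.
move=> hf heta /(_ k) [hnear hdr].
pose r (a : R) (u : 'rV[R]_N * 'M[R]_(s, N)) :=
  relax_res f eta rk dt k a u.1 u.2.
have dr q : differentiable
    (fun q : R * ('rV[R]_N * 'M[R]_(s, N)) => r q.1 q.2) q.
  exact: differentiable_relax_res.
have dgam : differentiable (gamma k) u0 by have [] := nbhs_singleton hnear.
have r0 : \forall u \near u0, r (gamma k u) u = 0.
  by apply: filterS hnear => u [].
split=> [|i].
  apply: (implicit_grad (r := r) (u0 := u0)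
           (phi := fun z => (z, stages ybar k))) => //; exact: ex_diff.
apply: (implicit_grad (r := r) (u0 := u0)
  (phi := fun z => (stepv ybar (prevpt k), setrow (stages ybar k) i z))) => //.
by case: (is_diff_embed_Y i).
Qed.

(** The differential at the pair (step value, stages) splits along the two
    components, and the stage component splits further along the rows of the
    stage matrix; each summand is a partial gradient. *)
Lemma is_diff_gammav : differentiable (gamma k) u0 ->
  is_diff ybar (fun y => gammav gamma y k)
    (fun h => dotv (stepv h (prevpt k)) (grad_y_gamma gamma ybar k) +
       \sum_i dotv (stage h k i) (grad_Y_gamma gamma ybar k i)).
Proof.
move=> dgam; have idgam := differentiableP dgam.
have hb := is_diff_pair (is_diff_linear_mx ybar (stepv_linear (prevpt k)))
                        (is_diff_linear_mx ybar (stages_linear k)).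
have hg := is_diff_comp hb idgam.
apply: is_diff_eq hg _; apply/funext => h /=.
have Ey : 'd (gamma k) u0 (stepv h (prevpt k), 0) =
    dotv (stepv h (prevpt k)) (grad_y_gamma gamma ybar k).
  have hc := is_diff_comp is_diff_embed_y idgam.
  rewrite /grad_y_gamma -diff_dotv; last exact: (@ex_diff _ _ _ _ _ _ _ hc).
  by rewrite (@diff_val _ _ _ _ _ _ _ hc).
have EY i : 'd (gamma k) u0 (0, setrow 0 i (stage h k i)) =
    dotv (stage h k i) (grad_Y_gamma gamma ybar k i).
  have idgam' := idgam; rewrite -[u0](embed_Y_stage i) in idgam'.
  have hc := is_diff_comp (is_diff_embed_Y i) idgam'.
  rewrite /grad_Y_gamma -diff_dotv; last exact: (@ex_diff _ _ _ _ _ _ _ hc).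
  by rewrite (@diff_val _ _ _ _ _ _ _ hc) /= embed_Y_stage.
rewrite -Ey -(eq_bigr _ (fun i _ => EY i)) -linear_sum -linearD /=.
congr ('d (gamma k) u0 _).
have -> : \sum_i (0, setrow 0 i (stage h k i)) =
    (0, \sum_i setrow 0 i (stage h k i)) :> 'rV[R]_N * 'M[R]_(s, N).
  rewrite [LHS]surjective_pairing; congr (_, _).
    by rewrite (raddf_sum fst) big1.
  by rewrite (raddf_sum snd).
congr (_, _); rewrite /= ?addr0 ?add0r //.
apply/row_matrixP => i; rewrite linear_sum (bigD1 i) //= rowK eqxx.
by rewrite big1 ?addr0 // => j ji; rewrite rowK eq_sym (negPf ji) row0.
Qed.

End Gamma.

(** * The adjoint of the linearized scheme *)

Lemma is_diff_comp_Jac (R : realType) (V : normedModType R) (m n : nat)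
  (g : 'rV[R]_m -> 'rV[R]_n) (L : V -> 'rV[R]_m) (x : V) :
  is_diff x L L -> differentiable g (L x) ->
  is_diff x (fun z => g (L z)) (fun h => L h *m (Jac g (L x))^T).
Proof.
move=> hL hg; have hc := is_diff_comp hL (differentiableP hg).
by apply: is_diff_eq hc _; apply/funext => h /=; rewrite trmxK mul_rV_lin1.
Qed.

Section Adjoint.
Variables (R : realType) (N s K : nat) (f : 'rV[R]_N -> R -> 'rV[R]_N).
Variables (yinit : 'rV[R]_N) (rk : tableau R s) (dt : R).
Variable gamma : 'I_K -> 'rV[R]_N * 'M[R]_(s, N) -> R.
Variable ybar : 'rV[R]_(bdim N s K).

Let g k := gammav gamma ybar k.
Let F k i := Fst f rk dt k (stages ybar k) i.
Let J k i := Jst f rk dt k (stages ybar k) i.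
Let gy k := grad_y_gamma gamma ybar k.
Let gY k i := grad_Y_gamma gamma ybar k i.

Definition dgammav (h : 'rV[R]_(bdim N s K)) (k : 'I_K) : R :=
  dotv (stepv h (prevpt k)) (gy k) + \sum_i dotv (stage h k i) (gY k i).

Definition dEtilde (h : 'rV[R]_(bdim N s K)) : 'rV[R]_(bdim N s K) :=
  bpack (stepv h ord0)
    (fun k => \matrix_(i < s)
       (stage h k i - stepv h (prevpt k)
        - dt *: \sum_j rka rk i j *: (stage h k j *m (J k j)^T)))
    (fun k => stepv h (nextpt k) - stepv h (prevpt k)
       - ((g k * dt) *: (\sum_i rkb rk i *: (stage h k i *m (J k i)^T))
          + (dgammav h k * dt) *: \sum_i rkb rk i *: F k i)).

Lemma is_diff_Etilde :
  (forall (t : R) (y : 'rV[R]_N), differentiable (f ^~ t) y) ->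
  (forall k, differentiable (gamma k) (stepv ybar (prevpt k), stages ybar k)) ->
  is_diff ybar (Etilde f yinit rk dt gamma) dEtilde.
Proof.
move=> hf hgam.
have dstep j := is_diff_linear_mx ybar (stepv_linear j).
have dstage k i := is_diff_linear_mx ybar (stage_linear k i).
have dF k i : is_diff ybar (fun y => Fst f rk dt k (stages y k) i)
    (fun h => stage h k i *m (J k i)^T).
  exact: is_diff_comp_Jac (dstage k i) (hf _ _).
have dsum (c : 'I_s -> R) k :
    is_diff ybar (fun y => \sum_i c i *: Fst f rk dt k (stages y k) i)
      (fun h => \sum_i c i *: (stage h k i *m (J k i)^T)).
  by apply: is_diff_sum => i; apply: is_diffZ.
apply: is_diff_bpack => [|k|k].
- have h := is_diffB (dstep ord0) (is_diff_cst yinit ybar).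
  by apply: is_diff_eq h _; rewrite subr0.
- apply: is_diff_mx => i j.
  have h := is_diff_entry 0 j (is_diffB
    (is_diffB (dstage k i) (dstep (prevpt k)))
    (is_diffZ dt (dsum (rka rk i) k))).
  have E1 : (fun y : 'rV[R]_(bdim N s K) => (\matrix_(i < s)
       (stage y k i - stepv y (prevpt k)
        - dt *: \sum_j rka rk i j *: Fst f rk dt k (stages y k) j)) i j) =
      (fun y => (stage y k i - stepv y (prevpt k)
        - dt *: \sum_j rka rk i j *: Fst f rk dt k (stages y k) j) 0 j).
    by apply/funext => y; rewrite mxE.
  rewrite E1; apply: is_diff_eq h _; apply/funext => y.
  by rewrite [RHS]mxE.
have dgdt : is_diff ybar (fun y => gammav gamma y k * dt)
    (fun h => dgammav h k * dt).
  have h := is_diffM (is_diff_gammav (hgam k)) (is_diff_cst dt ybar).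
  apply: is_diff_eq h _; apply/funext => h.
  by rewrite fctE /= scaler0 add0r; exact: mulrC.
exact: is_diffB (is_diffB (dstep (nextpt k)) (dstep (prevpt k)))
                (is_diff_scale dgdt (dsum (rkb rk) k)).
Qed.

(** [adj_step] and [adj_stage] collect what the equations of step [k]
    contribute to the adjoint equation of the value that starts this step,
    respectively of its stage [i], beyond the identity part of the
    linearization. *)
Definition adj_step (lam : 'rV[R]_(bdim N s K)) (k : 'I_K) : 'rV[R]_N :=
  stepv lam (nextpt k) + \sum_i stage lam k i + xi f rk dt ybar lam k *: gy k.

Definition adj_stage (lam : 'rV[R]_(bdim N s K)) (k : 'I_K) (i : 'I_s)
  : 'rV[R]_N :=
  dt *: (((g k * rkb rk i) *: stepv lam (nextpt k)
          + \sum_j rka rk j i *: stage lam k j) *m J k i)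
  + xi f rk dt ybar lam k *: gY k i.

(** Transposition within one step.  Exchanging the two sums over stages turns
    the coefficients [a_ij] into [a_ji], moving the Jacobians to the right
    argument turns them into their transposes, and pairing the term that
    contains the variation of [gamma_k] with the multiplier of the step leaves
    that variation times [xi]. *)
Lemma dotv_one_step (h lam : 'rV[R]_(bdim N s K)) (k : 'I_K) :
  \sum_i dotv (stage (dEtilde h) k i) (stage lam k i)
  + dotv (stepv (dEtilde h) (nextpt k)) (stepv lam (nextpt k)) =
  \sum_i dotv (stage h k i) (stage lam k i - adj_stage lam k i)
  + dotv (stepv h (nextpt k)) (stepv lam (nextpt k))
  - dotv (stepv h (prevpt k)) (adj_step lam k).
Proof.
pose M i j := dotv (stage h k j *m (J k j)^T) (stage lam k i).
pose lamk := stepv lam (nextpt k).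
pose hp := stepv h (prevpt k).
pose B := \sum_i rkb rk i * dotv (stage h k i *m (J k i)^T) lamk.
pose A := \sum_i \sum_j rka rk i j * M i j.
pose HL := \sum_i dotv (stage h k i) (stage lam k i).
have -> : \sum_i dotv (stage (dEtilde h) k i) (stage lam k i) =
    HL - dotv hp (\sum_i stage lam k i) - dt * A.
  rewrite dotv_sumr /A mulr_sumr -!sumrB; apply: eq_bigr => i _.
  rewrite stage_bpack rowK !dotvBl dotvZl dotv_suml; congr (_ - dt * _).
  by apply: eq_bigr => j _; rewrite dotvZl.
have -> : \sum_i dotv (stage h k i) (stage lam k i - adj_stage lam k i) =
    HL - (dt * (g k * B + A)
          + xi f rk dt ybar lam k * \sum_i dotv (stage h k i) (gY k i)).
  have -> : A = \sum_i \sum_j rka rk j i * M j i by exact: exchange_big.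
  rewrite /HL /B mulr_sumr -big_split !mulr_sumr -big_split -sumrB /=.
  apply: eq_bigr => i _.
  rewrite dotvBr /adj_stage dotvDr !dotvZr -dotv_mulmxtr dotvDr dotvZr.
  congr (_ - (dt * (_ + _) + _)); first by rewrite mulrA.
  by rewrite dotv_sumr; apply: eq_bigr => j _; rewrite dotvZr.
have xiE : xi f rk dt ybar lam k = dt * dotv (\sum_i rkb rk i *: F k i) lamk.
  by rewrite dotv_suml; congr (_ * _); apply: eq_bigr => i _; rewrite dotvZl.
have -> : B = dotv (\sum_i rkb rk i *: (stage h k i *m (J k i)^T)) lamk.
  by rewrite dotv_suml; apply: eq_bigr => i _; rewrite dotvZl.
rewrite stepv_bpackS /adj_step /dgammav !dotvBl dotvDl !dotvZl !dotvDr dotvZr.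
rewrite xiE -/lamk -/hp; ring.
Qed.

(** In this form [unlift ord_max] recovers the step that starts at a given time
    point, and finds none exactly at the last one. *)
Lemma prevpt_lift (k : 'I_K) : prevpt k = lift ord_max k.
Proof. by apply: val_inj; rewrite /= /bump leqNgt ltn_ord. Qed.

(** The transposed Jacobian applied to [lam].  The last time point starts no
    step, so nothing is subtracted there. *)
Definition Etilde_adj (lam : 'rV[R]_(bdim N s K)) : 'rV[R]_(bdim N s K) :=
  let res j := stepv lam j - oapp (adj_step lam) 0 (unlift ord_max j) in
  bpack (res ord0)
    (fun k => \matrix_(i < s) (stage lam k i - adj_stage lam k i))
    (fun k => res (nextpt k)).

Lemma stepv_Etilde_adj lam j : stepv (Etilde_adj lam) j =
  stepv lam j - oapp (adj_step lam) 0 (unlift ord_max j).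
Proof.
case: (unliftP ord0 j) => [k|] ->; first exact: stepv_bpackS.
exact: stepv_bpack0.
Qed.

Lemma stage_Etilde_adj lam k i :
  stage (Etilde_adj lam) k i = stage lam k i - adj_stage lam k i.
Proof. by rewrite stage_bpack rowK. Qed.

(** Summation by parts in time: on the left the step values are grouped by the
    step that they belong to, on the right by time point. *)
Lemma dEtilde_adjoint (h lam : 'rV[R]_(bdim N s K)) :
  dotv (dEtilde h) lam = dotv h (Etilde_adj lam).
Proof.
rewrite !dotv_bvec.
under [in RHS]eq_bigr => j _ do rewrite stepv_Etilde_adj dotvBr.
rewrite sumrB [X in _ - X]big_ord_recr /= unlift_none /=.
(* The subtracted sum over time points has no last term: it is a sum over
   steps, indexed by their starting points. *)
under [X in _ - (X + _)]eq_bigr => k _ do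
  rewrite -/(prevpt k) {2}prevpt_lift liftK /=.
under [X in _ = _ + X]eq_bigr => k _ do
  under eq_bigr => i _ do rewrite stage_Etilde_adj.
rewrite big_ord_recl [in RHS]big_ord_recl stepv_bpack0.
rewrite -/(dotv _ _) -addrA -big_split /=.
rewrite (eq_bigr _ (fun k _ => etrans (addrC _ _) (dotv_one_step h lam k))).
rewrite sumrB big_split /=.
have -> : dotv (stepv h ord_max) 0 = 0 by rewrite -[0](scale0r 0) dotvZr mul0r.
by rewrite /nextpt; ring.
Qed.

End Adjoint.

Theorem lemma2 (R : realType) (N s K : nat)
  (f : 'rV[R]_N -> R -> 'rV[R]_N) (eta : 'rV[R]_N -> R) (yinit : 'rV[R]_N)
  (rk : tableau R s) (dt : R)
  (gamma : 'I_K -> 'rV[R]_N * 'M[R]_(s, N) -> R)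
  (ybar : 'rV[R]_(bdim N s K))
  (hf : forall (t : R) (y : 'rV[R]_N), differentiable (f ^~ t) y)
  (heta_smooth : smooth eta)
  (heta_convex : convex_function [set: 'rV[R]_N] eta)
  (hdt : 0 < dt)
  (hIDT : IDT_solution f eta yinit rk dt (gammav gamma ybar) ybar)
  (hgamma : implicit_gamma f eta rk dt gamma ybar) :
  (forall k : 'I_K,
     let g := gammav gamma ybar k in
     grad_y_gamma gamma ybar k =
       - (dr_dg f eta rk dt ybar k g)^-1 *: dr_dy f eta rk dt ybar k g /\
     forall i : 'I_s,
       grad_Y_gamma gamma ybar k i =
         - (dr_dg f eta rk dt ybar k g)^-1 *: dr_dY f eta rk dt ybar k g i) /\
  forall w lam : 'rV[R]_(bdim N s K),
    (Jac (Etilde f yinit rk dt gamma) ybar)^T *m lam^T = w^T <->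
    stepv lam ord_max = stepv w ord_max /\
    forall k : 'I_K,
      stepv lam (prevpt k) =
        stepv lam (nextpt k) + \sum_i stage lam k i
        + xi f rk dt ybar lam k *: grad_y_gamma gamma ybar k
        + stepv w (prevpt k) /\
      forall i : 'I_s,
        stage lam k i =
          dt *: (((gammav gamma ybar k * rkb rk i) *: stepv lam (nextpt k)
                  + \sum_j rka rk j i *: stage lam k j)
                 *m Jst f rk dt k (stages ybar k) i)
          + xi f rk dt ybar lam k *: grad_Y_gamma gamma ybar k i
          + stage w k i.
Proof.
split=> [k g|w lam]; first exact: grad_gamma.
have dgam k : differentiable (gamma k) (stepv ybar (prevpt k), stages ybar k).
  by have [/nbhs_singleton[]] := hgamma k.
have dE := is_diff_Etilde yinit rk dt hf dgam.
set A := Etilde_adj f rk dt gamma ybar lam.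
have JA : (Jac (Etilde f yinit rk dt gamma) ybar)^T *m lam^T = A^T.
  apply/row_matrixP => i; apply/rowP => j; rewrite ord1 trmxK !rowE mulmxA.
  by rewrite mul_rV_lin1 (@diff_val _ _ _ _ _ _ _ dE) -!dotvE dEtilde_adjoint.
rewrite JA; split=> [/trmx_inj Aw | [hmax hk]].
  rewrite -Aw; split=> [|k].
    by rewrite stepv_Etilde_adj unlift_none subr0.
  split=> [|i]; last by rewrite stage_Etilde_adj addrC subrK.
  by rewrite stepv_Etilde_adj {3}prevpt_lift liftK addrC subrK.
congr trmx; apply: bvec_ext => [j|k i].
  rewrite stepv_Etilde_adj; case: (unliftP ord_max j) => [k|] -> /=; last first.
    by rewrite subr0.
  have [+ _] := hk k; rewrite prevpt_lift => ->.
  by rewrite addrC addKr.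
have [_ /(_ i) +] := hk k; rewrite stage_Etilde_adj => ->.
by rewrite addrC addKr.
Qed.
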